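(* Every chordal $B_1$-EPG graph is an EPT graph, and the containment is proper: the class of chordal $B_1$-EPG graphs is a proper subclass of the class of EPT graphs.
   Context: All graphs are finite and simple. A graph is chordal if it has no induced cycle of length at least $4$. An EPG representation of a graph $G$ assigns to each vertex $v$ a path $P_v$ in the (rectangular) grid such that two distinct vertices are adjacent in $G$ if and only if their paths share at least one grid edge. A graph is $B_1$-EPG if it has an EPG representation in which every path has at most one bend (change of direction). A graph is EPT if it is the edge intersection graph of a family of paths in a tree: there is a tree $T$ and paths $P_v$ in $T$, one per vertex, such that two distinct vertices are adjacent if and only if their paths share at least one edge of $T$. *)

(* Defs.v *)
From HB Require Import structures.
From mathcomp Require Import all_boot all_order all_algebra.

Set Implicit Arguments.
Unset Strict Implicit.
Unset Printing Implicit Defensive.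

Record sgraph := SGraph {
  vertex :> finType;
  adj : rel vertex;
  adj_sym : symmetric adj;
  adj_irr : irreflexive adj
}.

(* Lists of distinct vertices, consecutive ones (cyclically) adjacent, with no
   chord; [next c] and its converse are the two neighbours along the cycle. *)
Definition induced_cycle (G : sgraph) (c : seq G) : Prop :=
  [/\ 2 < size c, uniq c, cycle (@adj G) c &
      {in c &, forall x y, adj x y -> y = next c x \/ x = next c y}].

Definition chordal (G : sgraph) : Prop :=
  forall c : seq G, induced_cycle c -> size c < 4.

Section Paths.
Variable T : eqType.

(* Simple paths given by their nonempty vertex list; a single vertex is a path
   without edges. *)
Definition is_path (e : rel T) (p : seq T) : bool :=
  if p is x :: s then path e x s && uniq p else false.

(* Edges are unordered: a path uses {a, b} when a and b are consecutive in it,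
   in either order. *)
Definition path_edge (p : seq T) (a b : T) : bool :=
  infix [:: a; b] p || infix [:: b; a] p.

Definition share_edge (p q : seq T) : Prop :=
  exists a b, path_edge p a b /\ path_edge q a b.

End Paths.

Definition edge_intersection_rep (G : sgraph) (T : eqType) (P : G -> seq T) :
    Prop :=
  forall u v : G, u != v -> (adj u v <-> share_edge (P u) (P v)).

Definition grid_point : Type := (int * int)%type.

Definition grid_adj (a b : grid_point) : bool :=
  `|a.1 - b.1|%N + `|a.2 - b.2|%N == 1.

(* For adjacent points: the grid edge ab is horizontal (otherwise vertical). *)
Definition horizontal (a b : grid_point) : bool := a.2 == b.2.

Fixpoint bends (p : seq grid_point) : nat :=
  if p is a :: ((b :: c :: _) as p') then
    (horizontal a b != horizontal b c) + bends p'
  else 0.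

Definition B_EPG (k : nat) (G : sgraph) : Prop :=
  exists P : G -> seq grid_point,
    (forall v, is_path grid_adj (P v) /\ bends (P v) <= k) /\
    edge_intersection_rep P.

Definition is_tree (T : sgraph) : Prop :=
  [/\ 0 < #|T|,
      forall x y : T, connect (@adj T) x y &
      forall c : seq T, uniq c -> 2 < size c -> ~~ cycle (@adj T) c].

Definition EPT (G : sgraph) : Prop :=
  exists2 T : sgraph, is_tree T &
    exists P : G -> seq T,
      (forall v, is_path (@adj T) (P v)) /\ edge_intersection_rep P.

(* Main.v *)
Require Import Defs.
From mathcomp Require Import all_boot all_order all_algebra.
From mathcomp Require Import zify.

Set Implicit Arguments.
Unset Strict Implicit.
Unset Printing Implicit Defensive.

(* Cut the used grid edges apart at every grid point and glue back two edges
   meeting there only when some path runs through both.  The paths survive in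
   the resulting graph, so it remains to see that this graph is a forest when
   [G] is chordal, i.e. that each of its edges e is a bridge.  A detour around e
   gives a closed walk in [G] leaving the clique of paths through e on one side
   of e and returning on the other.  In a chordal graph a Z/2-cochain vanishing
   on triangles vanishes on closed walks, so some triangle of [G] already goes
   around e, which is impossible for three L-shaped paths.  The 4-cycle is EPT
   but not chordal. *)

(** * Z/2-weights of closed walks in chordal graphs *)

Section WalkSum.
Variables (T : Type) (f : T -> T -> bool).

Fixpoint walk_sum (x : T) (p : seq T) : bool :=
  if p is y :: p' then f x y (+) walk_sum y p' else false.

Lemma walk_sum_cat x p q :
  walk_sum x (p ++ q) = walk_sum x p (+) walk_sum (last x p) q.
Proof. by elim: p x => //= y p IHp x; rewrite IHp addbA. Qed.

End WalkSum.

Lemma next_cat_cons (T : eqType) (s t : seq T) (y z : T) :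
  uniq (s ++ y :: z :: t) -> next (s ++ y :: z :: t) y = z.
Proof.
rewrite next_nth mem_cat mem_head orbT.
case: s => [|x s] /=; first by rewrite ?eqxx.
rewrite mem_cat !inE => /andP[/norP[xs /norP[xy _]]].
rewrite (negPf xy) cat_uniq => /and3P[_ /hasPn ys _].
rewrite index_cat (negPf (ys y (mem_head _ _))) /= eqxx addn0.
by rewrite nth_cat ltnNge leqnSn /= subSnn.
Qed.

Lemma next_rcons (T : eqType) (s : seq T) (x z : T) :
  uniq (x :: rcons s z) -> next (x :: rcons s z) z = x.
Proof.
move=> Us; rewrite next_nth -rcons_cons mem_rcons mem_head.
have zs : z \notin x :: s by move: Us; rewrite -rcons_cons rcons_uniq => /andP[].
have ->: index z (x :: rcons s z) = (size s).+1.
  by rewrite -rcons_cons -cats1 index_cat (negPf zs) /= eqxx addn0.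
by rewrite nth_default // size_rcons.
Qed.

Lemma notin_uniq_split (T : eqType) (s : seq T) : ~~ uniq s ->
  exists x s1 s2 s3, s = s1 ++ x :: s2 ++ x :: s3.
Proof.
elim: s => //= x s IHs; rewrite negb_and negbK => /orP[xs|/IHs].
  by case/splitPr: xs => s2 s3; exists x, [::], s2, s3.
by case=> y [s1 [s2 [s3 ->]]]; exists y, (x :: s1), s2, s3.
Qed.

Lemma split2 (T : eqType) (s : seq T) (x y : T) :
  x \in s -> y \in s -> x != y ->
  exists s1 s2 s3, s = s1 ++ x :: s2 ++ y :: s3 \/ s = s1 ++ y :: s2 ++ x :: s3.
Proof.
case/splitPr => s1 s2; rewrite mem_cat inE eq_sym => /orP[|/orP[/eqP->|]].
- by case/splitPr=> a b; exists a, b, s2; right; rewrite -catA.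
- by rewrite eqxx.
- by case/splitPr=> a b; exists s1, a, b; left.
Qed.

Section ChordalWalks.
Variables (G : sgraph) (f : rel G).
Hypothesis chordalG : chordal G.
Hypothesis f_sym : symmetric f.
Hypothesis f_tri : forall x y z, adj x y -> adj y z -> adj z x ->
  f x y (+) f y z (+) f z x = false.

(* A shortest closed walk of odd weight could not repeat a vertex nor have a
   chord, since either would split it into two shorter closed walks. *)
Lemma chordal_closed_walk x p :
  path (@adj G) x p -> last x p = x -> walk_sum f x p = false.
Proof.
have [n] := ubnP (size p); elim: n => // n IHn in x p * => ltn walk_p lastp.
(* From here on [p] omits the final return to [x], so that [x :: p] lists the vertices of the closed
   walk once around. *)
case/lastP: p => [|p z] // in ltn walk_p lastp *.
rewrite last_rcons in lastp; rewrite {z}lastp in ltn walk_p *.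
have [Up|/notin_uniq_split] := boolP (uniq (x :: p)); last first.
  case=> z [[|x' s1] [s2 [s3]]] /= [].
    move=> xz ps; subst z; move: ltn walk_p; rewrite ps rcons_cat rcons_cons -cat_rcons.
    rewrite cat_path walk_sum_cat last_rcons => ltn /andP[w1 w2].
    move: ltn; rewrite size_cat !size_rcons => ltn.
    rewrite !IHn ?last_rcons //; by rewrite ?size_rcons; lia.
  move=> _ ps; move: ltn walk_p.
  rewrite ps rcons_cat rcons_cons rcons_cat rcons_cons -cat_rcons -[s2 ++ _]cat_rcons.
  rewrite !cat_path !walk_sum_cat !last_rcons => ltn /and3P[w1 w2 w3].
  move: ltn; rewrite !size_cat !size_rcons => ltn.
  rewrite (IHn z (rcons s2 z)) ?last_rcons //; last by rewrite size_rcons; lia.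
  have := IHn x (rcons s1 z ++ rcons s3 x).
  rewrite cat_path walk_sum_cat last_cat size_cat !last_rcons !size_rcons.
  by move=> -> //; [lia | rewrite w1].
have [lt4|ge4] := ltnP (size (x :: p)) 4.
  case: p => [|y [|z [|? []]]] //= in ltn lt4 Up walk_p *.
  - by rewrite adj_irr in walk_p.
  - by rewrite f_sym addbF addbb.
  - by case/and4P: walk_p => a b c _; rewrite addbF addbA f_tri.
have [ind|] := boolP [forall y in x :: p, forall z in x :: p,
    adj y z ==> ((z == next (x :: p) y) || (y == next (x :: p) z))].
  suff /chordalG: induced_cycle (x :: p) by rewrite ltnNge ge4.
  split=> //; first exact: ltn_trans ge4.
  move=> y z yp zp yz; move/forall_inP/(_ y yp)/forall_inP/(_ z zp): ind.
  by rewrite yz => /orP[]/eqP; [left|right].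
rewrite negb_forall => /existsP[y]; rewrite negb_imply negb_forall.
case/andP=> yp /existsP[z]; rewrite negb_imply negb_imply => /and3P[zp yz].
rewrite negb_or => /andP[zy' yz'].
have: exists y z s1 s2 s3, [/\ x :: p = s1 ++ y :: s2 ++ z :: s3,
    adj y z, z != next (x :: p) y & y != next (x :: p) z].
  have /(split2 yp zp)[s1 [s2 [s3 [e|e]]]] : y != z.
  - by apply: contraTneq yz => ->; rewrite adj_irr.
  - by exists y, z, s1, s2, s3.
  - by exists z, y, s1, s2, s3; rewrite adj_sym.
case=> {yp zp yz zy' yz'}y [{}z [s1 [s2 [s3 [e yz zy' yz']]]]].
(* The ends of the chord are not consecutive on the cycle, so each of the two arcs between them has
   an inner vertex. Closing either arc by the chord therefore gives a strictly shorter walk. *)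
have s2_n0 : s2 != [::].
  apply: contra zy' => /eqP s20; rewrite e s20 next_cat_cons //.
  by move: Up; rewrite e s20.
have s13_n0 : (s1 != [::]) || (s3 != [::]).
  rewrite -negb_and; apply: contra yz' => /andP[/eqP s10 /eqP s30].
  move: Up; rewrite e s10 s30 cat0s cats1 => Up.
  by rewrite next_rcons.
have [r er] : exists r, rcons s3 x = r by exists (rcons s3 x).
have lr : last z r = x by rewrite -er last_rcons.
have sr : size r = (size s3).+1 by rewrite -er size_rcons.
have zy : adj z y by rewrite adj_sym.
case: s1 => [|x' s1] /= in e s13_n0.
  case: e => xy ep; subst y.
  move: ltn walk_p; rewrite ep rcons_cat rcons_cons er -cat_rcons.
  rewrite cat_path last_rcons walk_sum_cat last_rcons size_cat size_rcons.
  move=> ltn /andP[w1 w2].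
  have := IHn x (rcons s2 z ++ [:: x]).
  rewrite size_cat size_rcons cat_path w1 walk_sum_cat !last_rcons /= last_cat /=.
  rewrite zy /= addbF => H1.
  have := IHn x (z :: r); rewrite /= yz w2 lr => H2.
  have : f x z (+) walk_sum f z r = false.
    by apply: H2 => //; move: s2_n0 ltn sr; clear; case: s2 => //= *; lia.
  have : walk_sum f x (rcons s2 z) (+) f z x = false.
    by apply: H1 => //; move: s13_n0 ltn sr; clear; case: s3 => //= *; lia.
  rewrite [f z x]f_sym.
  by case: (walk_sum f x _) (f x z) (walk_sum f z _) => [] [] [].
case: e => xx' ep; subst x'.
move: ltn walk_p.
rewrite ep rcons_cat rcons_cons rcons_cat rcons_cons er -cat_rcons -[s2 ++ _]cat_rcons.
rewrite !cat_path !walk_sum_cat !last_rcons !size_cat !size_rcons.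
move=> ltn /and3P[w1 w2 w3].
have := IHn y (rcons s2 z ++ [:: y]).
rewrite size_cat size_rcons cat_path w2 walk_sum_cat !last_rcons /= last_cat /=.
rewrite zy /= addbF => H1.
have := IHn x (rcons s1 y ++ z :: r).
rewrite size_cat size_rcons cat_path w1 walk_sum_cat !last_rcons /= last_cat /=.
rewrite yz w3 lr => H2.
have : walk_sum f x (rcons s1 y) (+) (f y z (+) walk_sum f z r) = false.
  by apply: H2 => //; move: s2_n0 ltn sr; clear; case: s2 => //= *; lia.
have : walk_sum f y (rcons s2 z) (+) f z y = false.
  by apply: H1 => //; move: ltn sr; clear; lia.
rewrite [f z y]f_sym.
by case: (walk_sum f y _) (f y z) (walk_sum f z _) (walk_sum f x _) => [] [] [] [].
Qed.

End ChordalWalks.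

(* For symmetric [e], the set [I] witnesses that deleting the edge [xy]
   separates [x] from [y]. *)
Definition bridge (T : Type) (e : T -> T -> bool) (x y : T) : Prop :=
  exists I : T -> Prop, [/\ I x, ~ I y &
    forall z z', e z z' -> I z -> I z' \/ z = x /\ z' = y].

(** * The graph of glued darts and its bridges *)

Section DartClasses.
Variables (G : sgraph) (V : finType) (E : G -> rel V).

(* The dart [(p, q)] is the edge [pq] seen from its end [p]. *)
Definition dart_rel (d d' : V * V) : bool :=
  (d.1 == d'.1) && [exists v, E v d.1 d.2 && E v d'.1 d'.2].

(** A class of glued darts, represented by one of its members: a point is split into one node for
    each class of darts leaving it. *)
Definition node (d : V * V) : V * V := fingraph.root dart_rel d.

Definition node_adj (x y : V * V) : bool :=
  [exists v, exists p, exists q,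
    [&& E v p q, node (p, q) == x & node (q, p) == y]].

Lemma dart_rel_sym : symmetric dart_rel.
Proof.
by move=> d d'; rewrite /dart_rel eq_sym; under eq_existsb => v do rewrite andbC.
Qed.

Lemma dart_connect_sym : connect_sym dart_rel.
Proof. exact/sym_connect_sym/dart_rel_sym. Qed.

Lemma eq_node p q r v : E v p q -> E v p r -> node (p, q) = node (p, r).
Proof.
move=> vq vr; apply/(fingraph.rootP dart_connect_sym)/connect1.
by rewrite /dart_rel eqxx; apply/existsP; exists v; rewrite /= vq.
Qed.

(** Darts are glued only at a common point, so a node remembers its point. This keeps the two ends
    of an edge distinct and lets lifted paths be projected back. *)
Lemma node_fst d : (node d).1 = d.1.
Proof.
have /closed_connect/(_ _ _ (connect_root dart_rel d)) :
    closed dart_rel [pred x | x.1 == d.1].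
  by move=> x y /andP[/eqP xy _]; rewrite !inE xy.
by rewrite !inE eqxx => /esym/eqP.
Qed.

Hypothesis E_sym : forall v, symmetric (E v).
Hypothesis E_irr : forall v, irreflexive (E v).

Lemma node_adj_sym : symmetric node_adj.
Proof.
suff H x y : node_adj x y -> node_adj y x by move=> x y; apply/idP/idP; apply: H.
case/existsP=> v /existsP[p /existsP[q /and3P[vpq px qy]]].
apply/existsP; exists v; apply/existsP; exists q; apply/existsP; exists p.
by rewrite E_sym vpq px qy.
Qed.

Lemma node_adj_irr : irreflexive node_adj.
Proof.
move=> x; apply: contraTF isT => /existsP[v /existsP[p /existsP[q]]].
case/and3P=> vpq px qy.
have /= := node_fst (p, q); rewrite (eqP px) -(eqP qy) node_fst /= => qp.
by rewrite qp E_irr in vpq.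
Qed.

Hypothesis chordalG : chordal G.
Hypothesis adjE : forall u v, u != v ->
  (adj u v <-> exists p q, E u p q /\ E v p q).

Section Bridge.
Variables (p0 q0 : V) (side : pred V).
Hypotheses (side_p0 : side p0) (side_q0 : ~~ side q0).

Let S v := E v p0 q0.
Let meet b u v := [exists p, exists q,
  [&& E u p q, E v p q, side p == b & side q == b]].

(** These three conditions are all that the bridge argument takes from geometry. The last two
    exclude the triangles of [G] that go around [p0q0], with two vertices in [S] or with one; the
    case [s = s'] of [meet_one_side] is included. *)
Hypothesis one_crossing : forall v p q,
  S v -> E v p q -> side p -> ~~ side q -> p = p0 /\ q = q0.
Hypothesis meet_one_side : forall s s' w,
  S s -> S s' -> ~~ S w -> meet true s w -> ~~ meet false s' w.
Hypothesis no_claw : forall s w u, S s -> ~~ S w -> ~~ S u ->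
  meet true s w -> meet false s u -> ~~ adj w u.

Let meetC b u v : meet b u v = meet b v u.
Proof.
by apply: eq_existsb => p; apply: eq_existsb => q; rewrite andbCA.
Qed.

(** A path in [S] changes side only along [p0q0], which [u] avoids, so both ends of a shared edge
    lie on the same side. *)
Let meet_intro v u p q : S v -> ~~ S u -> E v p q -> E u p q ->
  meet (side p) v u.
Proof.
move=> Sv nSu vpq upq; apply/existsP; exists p; apply/existsP; exists q.
rewrite vpq upq eqxx /=.
case: (boolP (side p)) (boolP (side q)) => sp [] sq //.
  case: (one_crossing Sv vpq sp sq) => pp qq.
  by move: nSu; rewrite /S -pp -qq upq.
have [|qq pp] := one_crossing Sv _ sq sp; first by rewrite E_sym.
by move: nSu; rewrite /S -pp -qq E_sym upq.
Qed.

Let adj_meet v u : S v -> ~~ S u -> adj v u -> meet true v u || meet false v u.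
Proof.
move=> Sv nSu vu; have /adjE : v != u by apply: contraNneq nSu => <-.
case=> /(_ vu)[p [q [vpq upq]]] _; have := meet_intro Sv nSu vpq upq.
by case: (side p) => ->; rewrite ?orbT.
Qed.

(* A vertex through [p0q0] and one avoiding it get weight 1 when they meet
   beyond [q0]; this cochain vanishes on triangles. *)
Let weight u v := (S u != S v) && meet false u v.

Let weight_sym : symmetric weight.
Proof. by move=> u v; rewrite /weight eq_sym meetC. Qed.

(** A triangle has either no edge or exactly two edges between [S] and its complement. The two have
    equal weight, by [meet_one_side] if their common vertex is outside [S] and by [no_claw] if it is
    in [S]. *)
Let weight_tri x y z : adj x y -> adj y z -> adj z x ->
  weight x y (+) weight y z (+) weight z x = false.
Proof.
have two s s' w : S s -> S s' -> ~~ S w -> adj s w -> adj s' w ->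
    meet false s w = meet false s' w.
  move=> Ss Ss' nSw /(adj_meet Ss nSw) sw /(adj_meet Ss' nSw) s'w.
  apply/idP/idP=> H.
    have := contraL (@meet_one_side _ _ _ Ss' Ss nSw) H.
    by case/orP: s'w => ->.
  have := contraL (@meet_one_side _ _ _ Ss Ss' nSw) H.
  by case/orP: sw => ->.
have one s w u : S s -> ~~ S w -> ~~ S u -> adj s w -> adj s u -> adj w u ->
    meet false s w = meet false s u.
  move=> Ss nSw nSu /(adj_meet Ss nSw) sw /(adj_meet Ss nSu) su wu.
  apply/idP/idP=> H.
    case/orP: su => // su; have := no_claw Ss nSu nSw su H.
    by rewrite adj_sym wu.
  by case/orP: sw => // sw; have := no_claw Ss nSw nSu sw H; rewrite wu.
move=> xy yz zx; have yx := xy; have zy := yz; have xz := zx.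
rewrite adj_sym in yx; rewrite adj_sym in zy; rewrite adj_sym in xz.
rewrite /weight; case: (boolP (S x)) (boolP (S y)) (boolP (S z)) => Sx [] Sy [] Sz //=.
- by rewrite ?addFb [meet _ z x]meetC (two y x z) // addbb.
- by rewrite ?addbF (two x z y) // [meet _ z y]meetC addbb.
- by rewrite ?addbF [meet _ z x]meetC (one x y z) // addbb.
- by rewrite [meet _ x y]meetC (two y z x) // addbF addbb.
- by rewrite ?addbF [meet _ x y]meetC (one y x z) // addbb.
- by rewrite ?addFb [meet _ y z]meetC (one z y x) // addbb.
Qed.

Let off u v := [&& adj u v, ~~ S u & ~~ S v].

(** Otherwise the walk from [w] to [u] outside [S], closed up through [s'] and [s], has total weight
    1: only its step from [u] to [s'] has nonzero weight. This contradicts [chordal_closed_walk]. *)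
Let not_both s s' w u : S s -> S s' -> ~~ S w -> connect off w u ->
  meet true s w -> ~~ meet false s' u.
Proof.
move=> Ss Ss' nSw /connectP[p p_off ->] sw; apply/negP => s'u.
have [nSu p_adj p0_sum] : [/\ ~~ S (last w p), path (@adj G) w p
    & walk_sum weight w p = false].
  elim: p w nSw p_off {sw s'u} => //= v p IHp w nSw /andP[/and3P[wv _ nSv] pv].
  by have [? ? ->] := IHp _ nSv pv; rewrite wv /weight (negPf nSw) (negPf nSv).
set u0 := last w p in s'u nSu.
have meet_adj b x y : x != y -> meet b x y -> adj x y.
  move=> /adjE[_ H] /existsP[a /existsP[c /and4P[xa ya _ _]]].
  by apply: H; exists a, c.
have S_neq x y : S x -> ~~ S y -> x != y by move=> ? H; apply: contraNneq H => <-.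
have adj_sw : adj s w by apply: meet_adj sw; apply: S_neq.
have adj_us' : adj u0 s' by rewrite adj_sym; apply: meet_adj s'u; apply: S_neq.
have w1 : weight s w = false.
  by rewrite /weight (negPf (meet_one_side Ss Ss nSw sw)) andbF.
have w2 : weight u0 s' by rewrite /weight Ss' (negPf nSu) meetC.
have [ss'|ss'] := eqVneq s s'.
  have := chordal_closed_walk chordalG weight_sym weight_tri (x := s)
    (p := w :: rcons p s).
  rewrite /= adj_sw rcons_path p_adj -/u0 last_rcons w1 -cats1 walk_sum_cat.
  by rewrite p0_sum /= -/u0 ss' adj_us' w2 => /(_ erefl erefl).
have adj_s's : adj s' s.
  by rewrite adj_sym; apply/adjE => //; exists p0, q0.
have := chordal_closed_walk chordalG weight_sym weight_tri (x := s)
    (p := w :: p ++ [:: s'; s]).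
rewrite /= adj_sw cat_path p_adj last_cat /= -/u0 adj_us' adj_s's w1 walk_sum_cat.
rewrite p0_sum /= -/u0 w2 /weight Ss Ss' /= => /(_ erefl erefl).
by [].
Qed.

(* The [p0]-side of the edge [p0q0] in the graph of nodes. *)
Let near (d : V * V) : Prop :=
  d = (p0, q0) \/
  [/\ d <> (p0, q0), d <> (q0, p0) &
      (exists v, [/\ S v, E v d.1 d.2 & side d.1]) \/
      (exists v, [/\ ~~ S v, E v d.1 d.2 &
         exists s w, [/\ S s, ~~ S w, meet true s w & connect off w v]])].

Let off_trans w u v p q : ~~ S u -> ~~ S v -> E u p q -> E v p q ->
  connect off w u -> connect off w v.
Proof.
move=> nSu nSv uE vE wu; have [<- //|uv] := eqVneq u v.
apply: connect_trans wu (connect1 _); rewrite /off nSu nSv !andbT.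
by apply/adjE => //; exists p, q.
Qed.

Let near_rel d d' : dart_rel d d' -> near d -> near d'.
Proof.
case: d d' => p q [_ r] /andP[/= /eqP <- /existsP[v /andP[/= vq vr]]] nd.
have [[-> ->]|npr] := eqVneq (p, r) (p0, q0); first by left.
have p0q0 : p0 != q0 by apply: contraTneq side_p0 => ->.
have E0 : S v || ((p, q) != (p0, q0)).
  by case: eqP => [[pp qq]|]; rewrite ?orbT // /S -pp -qq vq.
(* The path [v] that glues the two darts inherits the nearness of the first one in a form that
   mentions neither [q] nor [r], so it passes on to the second. The critical case, [v] in [S]
   meeting [u] beyond [q0], is excluded by [not_both]. *)
have reach : S v && side p \/ (~~ S v /\
    exists s w, [/\ S s, ~~ S w, meet true s w & connect off w v]).
  case: nd => [[pp qq]|[_ _ [[u [Su uq sp]]|[u [nSu uq [s [w [Ss nSw sw wu]]]]]]]].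
  - by left; rewrite /S pp side_p0 -{1}pp -qq vq.
  - have [Sv|nSv] := boolP (S v); first by left; exact: sp.
    right; split=> //; exists u, v; split=> //.
    by have := meet_intro Su nSv uq vq; rewrite /= in sp; rewrite sp.
  - have [Sv|nSv] := boolP (S v).
      left=> /=; have := meet_intro Sv nSu vq uq.
      case: (side p) => // vu.
      by have := not_both Ss Sv nSw wu sw; rewrite vu.
    right; split=> //; exists s, w; split=> //.
    exact: off_trans nSu nSv uq vq wu.
right; split; first exact/eqP.
- case=> pp rr; case: reach => [/andP[_]|[nSv _]].
    by rewrite pp (negPf side_q0).
  by move: nSv; rewrite /S E_sym -pp -rr vr.
- case: reach => [/andP[Sv sp]|[nSv H]]; [left|right]; exists v; by split.
Qed.

Let near_connect d d' : connect dart_rel d d' -> near d -> near d'.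
Proof.
case/connectP=> p pth ->; elim: p d pth => //= d1 p IHp d /andP[dd1 pth] nd.
exact: IHp pth (near_rel dd1 nd).
Qed.

Let near_node d : near (node d) <-> near d.
Proof.
by split; apply: near_connect; rewrite ?[connect _ (node d) _]dart_connect_sym connect_root.
Qed.

(** By [near_node] nearness depends only on the node, so it remains to reverse a dart. A path in [S]
    stays on its side except along [p0q0]; for a path outside [S] the witness ignores the direction
    of the dart. *)
Lemma node_bridge : bridge (node_adj) (node (p0, q0)) (node (q0, p0)).
Proof.
exists near; split.
- by apply/near_node; left.
- case/near_node => [[qp _]|[_ //]].
  by move: side_q0; rewrite qp side_p0.
move=> _ _ /existsP[v /existsP[p /existsP[q /and3P[vpq /eqP<- /eqP<-]]]].
move/near_node => npq; have [[-> ->]|ne] := eqVneq (p, q) (p0, q0); first by right.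
left; apply/near_node; case: npq ne => [->|]; first by rewrite eqxx.
case=> /= n1 n2 H _.
right; split.
- by case=> qq pp; apply: n2; rewrite pp qq.
- by case=> qq pp; apply: n1; rewrite pp qq.
case: H => [[u [Su uE sp]]|[u [nSu uE H]]]; [left|right]; exists u.
  rewrite E_sym; split=> //; apply: contraPT isT => sq.
  by have [pp qq] := one_crossing Su uE sp sq; case: n1; rewrite pp qq.
by rewrite E_sym.
Qed.

End Bridge.
End DartClasses.

(** * Edges of vertex lists; cycles contain no bridge *)

Section PathEdge.
Variable T : eqType.
Implicit Types (s : seq T) (x y : T).

Lemma path_edge_cons a b s x y :
  path_edge (a :: b :: s) x y =
  [|| (a == x) && (b == y), (a == y) && (b == x) | path_edge (b :: s) x y].
Proof.
rewrite /path_edge !(infix_consl _ a) !prefix_cons !prefix0s !andbT.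
move: (infix [:: x; y] _) (infix [:: y; x] _) => i j.
rewrite !(eq_sym a) !(eq_sym b) -!orbA.
by rewrite [i || (_ || _)]orbCA.
Qed.

Lemma path_edge1 a x y : path_edge [:: a] x y = false.
Proof. by rewrite /path_edge !infixs1 /= !eqseq_cons !andbF. Qed.

Lemma path_edge_sym s : symmetric (path_edge s).
Proof. by move=> x y; rewrite /path_edge orbC. Qed.

Lemma path_edge_mem s x y : path_edge s x y -> x \in s /\ y \in s.
Proof.
by case/orP=> /mem_infix H; split; apply: H; rewrite !inE eqxx ?orbT.
Qed.

Lemma path_edge_irr s : uniq s -> irreflexive (path_edge s).
Proof.
move=> Us x; apply/negP; rewrite /path_edge orbb => /infix_uniq/(_ Us).
by rewrite /= inE eqxx.
Qed.

Lemma sorted_path_edge (e : rel T) s :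
  (forall x y, path_edge s x y -> e x y) -> sorted e s.
Proof.
elim: s => // a [|b s] //= IHs H.
rewrite H ?path_edge_cons ?eqxx //=; apply: IHs => x y xy.
by apply: H; rewrite path_edge_cons xy !orbT.
Qed.

End PathEdge.

Lemma path_edge_map (T U : eqType) (f : T -> U) s x y : injective f ->
  path_edge (map f s) (f x) (f y) = path_edge s x y.
Proof.
move=> f_inj; elim: s => // a [|b s] IHs; first by rewrite /= !path_edge1.
by rewrite !map_cons !path_edge_cons -IHs !(inj_eq f_inj).
Qed.

(** Going round the cycle from [y], away from [x], one never leaves the set [I] of the bridge [yx]:
    its only exit is the step from [y] to [x], and [y] does not occur again. Yet the walk ends in
    [x]. *)
Lemma bridge_acyclic (T : eqType) (e : rel T) (c : seq T) :
  symmetric e -> (forall x y, e x y -> bridge e x y) -> uniq c -> 2 < size c -> ~~ cycle e c.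
Proof.
move=> e_sym br; case: c => [|x [|y [|h s]]] //= Uc _.
apply/negP => /and3P[xy yh hs].
have [|I [Iy nIx Iout]] := br y x; first by rewrite e_sym.
have Ih : I h.
  by case: (Iout _ _ yh Iy) => // -[_ hx]; rewrite hx !inE eqxx !orbT in Uc.
have : y \notin h :: s by case/and3P: Uc.
elim: s h Ih hs {yh Uc} => [|k s IHs] h Ih /=.
  rewrite andbT => hx; rewrite inE => yh.
  by case: (Iout _ _ hx Ih) => // -[hy]; rewrite hy eqxx in yh.
case/andP=> hk ks; rewrite inE negb_or => /andP[yh yks].
apply: IHs ks yks; case: (Iout _ _ hk Ih) => // -[hy].
by rewrite hy eqxx in yh.
Qed.

(** * Completing a forest to a tree *)

Section ForestToTree.
Variables (V : finType) (e : rel V).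
Hypotheses (e_sym : symmetric e) (e_irr : irreflexive e).
Hypothesis e_bridge : forall x y, e x y -> bridge e x y.

(* [None] is a new vertex joined to one representative of each component. *)
Definition rooted_rel (x y : option V) : bool :=
  match x, y with
  | Some a, Some b => e a b
  | Some a, None | None, Some a => fingraph.root e a == a
  | None, None => false
  end.

Lemma rooted_sym : symmetric rooted_rel.
Proof. by case=> [a|] [b|] //=; apply: e_sym. Qed.

Lemma rooted_irr : irreflexive rooted_rel.
Proof. by case=> [a|] //=; apply: e_irr. Qed.

Definition rooted_tree := SGraph rooted_sym rooted_irr.

Lemma rooted_bridge x y : rooted_rel x y -> bridge rooted_rel x y.
Proof.
have cs : connect_sym e by apply: sym_connect_sym.
(* The component of a root [a] is joined to the rest only by the edge from [a] to [None]. *)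
have bridge_root a : fingraph.root e a = a ->
    forall z z', rooted_rel z z' ->
    let I x := if x is Some b then connect e b a else false in
    (I z != I z') -> (z, z') = (Some a, None) \/ (z, z') = (None, Some a).
  move=> ra [b|] [c|] //=.
  - by move=> bc; rewrite (same_connect cs (connect1 bc)) eqxx.
  - move=> /eqP rb; case: (boolP (connect e b a)) => // /(fingraph.rootP cs).
    by rewrite ra rb => ->; left.
  - move=> /eqP rb; case: (boolP (connect e c a)) => // /(fingraph.rootP cs).
    by rewrite ra rb => ->; right.
case: x y => [a|] [b|] //=.
- move=> ab; have [I [Ia nIb Iout]] := e_bridge ab.
  pose r := fingraph.root e a.
  have ra : connect e r a by rewrite cs connect_root.
  (* [None] and all other components hang on the component of [a] through its root [r], so they go
     to the side of [r]. *)
  exists (fun x => if x is Some c then if connect e c a then I c else I r else I r).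
  split; first by rewrite connect0.
    by rewrite cs connect1.
  move=> [c|] [d|] //=.
  + move=> cd; rewrite (same_connect cs (connect1 cd)).
    by case: ifP => _ Ic; [case: (Iout _ _ cd Ic) => [|[-> ->]]; auto | left].
  + move=> /eqP rc; case: ifP => [/(fingraph.rootP cs)|_]; last by left.
    by rewrite rc -/r => ->; left.
  + move=> /eqP rc; case: ifP => [/(fingraph.rootP cs)|_]; last by left.
    by rewrite rc -/r => ->; left.
- move=> /eqP ra.
  exists (fun x => if x is Some b then connect e b a else false).
  split; rewrite ?connect0 //= => z z' zz' Iz.
  have := bridge_root a ra z z' zz'; rewrite /= Iz.
  case: (if z' is Some _ then _ else _) => [_|/(_ isT)]; first by left.
  by case=> -[zE z'E]; [right; rewrite zE z'E | rewrite zE in Iz].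
- move=> /eqP rb.
  exists (fun x => ~~ if x is Some c then connect e c b else false).
  split; rewrite ?connect0 //= => z z' zz' /negbTE Iz.
  have := bridge_root b rb z z' zz'; rewrite /= Iz.
  case: (if z' is Some _ then _ else _) => [/(_ isT)|_]; last by left.
  by case=> -[zE z'E]; [rewrite zE connect0 in Iz | right; rewrite zE z'E].
Qed.

Lemma rooted_tree_is_tree : is_tree rooted_tree.
Proof.
split.
- by apply/card_gt0P; exists None.
- have cs : connect_sym rooted_rel by apply/sym_connect_sym/rooted_sym.
  suff H x : connect rooted_rel x None.
    by move=> x y; apply: connect_trans (H x) _; rewrite cs; apply: H.
  case: x => // a; pose r := fingraph.root e a.
  have /connectP[p pth lastp] : connect e a r := connect_root e a.
  apply: (@connect_trans _ _ (Some r)).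
    apply/connectP; exists (map Some p); last by rewrite last_map lastp.
    by rewrite path_map.
  apply: connect1; rewrite /= root_root //; exact: sym_connect_sym.
- move=> c Uc sc; apply: bridge_acyclic => //; first exact: rooted_sym.
  exact: rooted_bridge.
Qed.

End ForestToTree.

(** * Lifting the paths to the tree *)

Section LiftedRepresentation.
Variables (G : sgraph) (V : finType) (P : G -> seq V).
Hypotheses (P_n0 : forall v, P v != [::]) (P_uniq : forall v, uniq (P v)).
Hypothesis P_rep : edge_intersection_rep P.

Let E v := path_edge (P v).

Hypothesis bridgeE : forall v p q, E v p q ->
  bridge (node_adj E) (node E (p, q)) (node E (q, p)).

Let E_sym v : symmetric (E v). Proof. exact: path_edge_sym. Qed.
Let E_irr v : irreflexive (E v). Proof. exact: path_edge_irr. Qed.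

(** All edges of one path at [p] belong to one class, by [eq_node], so the choice among them is
    immaterial. The default [p] is taken only where the path has no edge, as for a path with a
    single vertex. *)
Let neighbour v p := if [pick q | E v p q] is Some q then q else p.
Let lift v p : option (V * V) := Some (node E (p, neighbour v p)).

Let liftE v p q : E v p q -> lift v p = Some (node E (p, q)).
Proof.
rewrite /lift /neighbour; case: pickP => [r pr pq|/(_ q)->] //.
by rewrite (eq_node pr pq).
Qed.

Let lift_eq u v p q : lift u p = lift v q -> p = q.
Proof. by case=> /(congr1 fst); rewrite !node_fst. Qed.

Let lift_inj v : injective (lift v).
Proof. by move=> p q; apply: lift_eq. Qed.

(** Two paths through a common edge have the same nodes at its ends, so their lifts share it too.
    Conversely, a shared edge of the lifts projects to a shared edge of the paths, since nodes
    remember their points. *)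
Lemma EPT_of_bridges : EPT G.
Proof.
have br x y : node_adj E x y -> bridge (node_adj E) x y.
  case/existsP=> v /existsP[p /existsP[q /and3P[vpq /eqP<- /eqP<-]]].
  exact: bridgeE vpq.
have T_tree := rooted_tree_is_tree (node_adj_sym E_sym) (node_adj_irr E_irr) br.
exists (rooted_tree (node_adj_sym E_sym) (node_adj_irr E_irr)) => //.
exists (fun v => map (lift v) (P v)); split=> [v|u v uv].
  have : sorted (rooted_rel (node_adj E)) (map (lift v) (P v)).
    apply: sorted_path_edge => x y xy.
    have [/mapP[p _ xp] /mapP[q _ yq]] := path_edge_mem xy.
    move: xy; rewrite xp yq path_edge_map // => pq.
    have qp := pq; rewrite path_edge_sym in qp.
    rewrite (liftE pq) (liftE qp) /=.
    apply/existsP; exists v; apply/existsP; exists p; apply/existsP; exists q.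
    by rewrite /E pq !eqxx.
  have : uniq (map (lift v) (P v)) by rewrite (map_inj_uniq (@lift_inj v)).
  by case: (P v) (P_n0 v) => //= a s _ -> ->.
apply: iff_trans (P_rep uv) _; split=> [[p [q [up vp]]]|[x [y [ux vy]]]].
  have [uq vq] := (up, vp); rewrite path_edge_sym in uq; rewrite path_edge_sym in vq.
  exists (lift u p), (lift u q); rewrite path_edge_map //; split=> //.
  by rewrite (liftE up) (liftE uq) -(liftE vp) -(liftE vq) path_edge_map.
have [/mapP[p _ xp] /mapP[q _ yq]] := path_edge_mem ux.
have [/mapP[p' _ xp'] /mapP[q' _ yq']] := path_edge_mem vy.
have pp : p' = p by apply: (@lift_eq v u); rewrite -xp -xp'.
have qq : q' = q by apply: (@lift_eq v u); rewrite -yq -yq'.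
exists p, q; split; first by move: ux; rewrite xp yq path_edge_map.
by move: vy; rewrite xp' yq' path_edge_map // pp qq.
Qed.

End LiftedRepresentation.

(** * Geometry of one-bend paths in the grid *)

Section Grid.

Import Order.TTheory GRing.Theory Num.Theory.
Local Open Scope ring_scope.

(** The unit segments of the interval spanned by [a] and [b], with both pairs of ends unordered. *)
Definition unit_step (a b s t : int) : bool :=
  ((t == s + 1) && ((a <= s < b) || (b <= s < a))) ||
  ((s == t + 1) && ((a <= t < b) || (b <= t < a))).

(* The edges of the path from [(a, y)] via the corner [(x, y)] to [(x, b)]. *)
Definition L_shape (x y a b : int) (p q : int * int) : bool :=
  [&& p.2 == y, q.2 == y & unit_step a x p.1 q.1] ||
  [&& p.1 == x, q.1 == x & unit_step b y p.2 q.2].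

Lemma unit_stepxx a s t : unit_step a a s t = false.
Proof. rewrite /unit_step; lia. Qed.

Lemma unit_stepC a b s t : unit_step a b s t = unit_step b a s t.
Proof. by rewrite /unit_step (orbC (_ <= s < _)) (orbC (_ <= t < _)). Qed.

Lemma unit_step_cons a b x s t : (b = a + 1 /\ a < x) \/ (b = a - 1 /\ x < a) ->
  unit_step a x s t =
  [|| (s == a) && (t == b), (t == a) && (s == b) | unit_step b x s t].
Proof. by rewrite /unit_step => -[] [-> ax]; apply/idP/idP; lia. Qed.

(** The induction needs the direction of the first step, and that the other arm is empty if there is
    no bend. A step in the same direction then lengthens the first arm, since a simple path cannot
    turn back. *)
Lemma L_path (a b : grid_point) s :
  path grid_adj a (b :: s) -> uniq (a :: b :: s) -> (bends (a :: b :: s) <= 1)%N ->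
  exists x y e f,
    path_edge (a :: b :: s) =2 L_shape x y e f /\
    ([/\ a.2 = y, b.2 = y, e = a.1,
         (b.1 = a.1 + 1 /\ a.1 < x) \/ (b.1 = a.1 - 1 /\ x < a.1)
       & bends (a :: b :: s) = 0%N -> f = y] \/
     [/\ a.1 = x, b.1 = x, f = a.2,
         (b.2 = a.2 + 1 /\ a.2 < y) \/ (b.2 = a.2 - 1 /\ y < a.2)
       & bends (a :: b :: s) = 0%N -> e = x]).
Proof.
have edge a1 a2 b1 b2 : grid_adj (a1, a2) (b1, b2) ->
    (b2 = a2 /\ (b1 = a1 + 1 \/ b1 = a1 - 1)) \/
    (b1 = a1 /\ (b2 = a2 + 1 \/ b2 = a2 - 1)).
  rewrite /grid_adj /=; lia.
elim: s a b => [|c s IHs] [a1 a2] [b1 b2].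
  rewrite /= andbT => /edge[[-> H]|[-> H]] _ _.
    exists b1, a2, a1, a2; split; last by left=> /=; split=> //; lia.
    move=> [p1 p2] [q1 q2]; rewrite path_edge_cons path_edge1 orbF /L_shape /unit_step /=.
    by rewrite !xpair_eqE; case: H => ->; apply/idP/idP; lia.
  exists a1, b2, a1, a2; split; last by right=> /=; split=> //; lia.
  move=> [p1 p2] [q1 q2]; rewrite path_edge_cons path_edge1 orbF /L_shape /unit_step /=.
  by rewrite !xpair_eqE; case: H => ->; apply/idP/idP; lia.
case: c => c1 c2 /andP[/edge ab pth] /andP[nab Us].
have -> : bends [:: (a1, a2), (b1, b2), (c1, c2) & s] =
  (((a2 == b2) != (b2 == c2)) + bends [:: (b1, b2), (c1, c2) & s])%N by [].
move=> le1.
have ac : ~ (a1 = c1 /\ a2 = c2).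
  by case=> ac1 ac2; move: nab; rewrite ac1 ac2 !inE eqxx orbT.
have [|x [y [e [f [IH ends]]]]] := IHs _ _ pth Us.
  by apply: leq_trans le1; apply: leq_addl.
have IHE p1 p2 q1 q2 : path_edge [:: (a1, a2), (b1, b2), (c1, c2) & s] (p1, p2) (q1, q2) =
   [|| [&& p1 == a1, p2 == a2, q1 == b1 & q2 == b2],
       [&& q1 == a1, q2 == a2, p1 == b1 & p2 == b2] | L_shape x y e f (p1, p2) (q1, q2)].
  by rewrite path_edge_cons IH !xpair_eqE -!andbA !(eq_sym a1) !(eq_sym a2)
    !(eq_sym b1) !(eq_sym b2).
move: (bends _) le1 ends {IHs pth Us nab} => n le1 ends.
case: ends => [] [/= hb hc he dir n0]; case: ab => [] [hab dab].
- exists x, y, a1, f; split; last by left; split=> //; clear IHE IH; lia.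
  move=> [p1 p2] [q1 q2]; rewrite IHE /L_shape /=; subst.
  rewrite (@unit_step_cons a1 b1); last by clear IHE IH; lia.
  by do ?[case: eqP => //= _]; rewrite ?andbF ?andbT ?orbT ?orbF.
(* The bend is at [b], so the rest is straight: [b] becomes the corner and the old corner coordinate
   [x] the end of the horizontal arm. *)
- exists b1, b2, x, a2; split; last by right; split=> //; clear IHE IH; lia.
  have {n0} fy : f = y by apply: n0; clear IHE IH; lia.
  move=> [p1 p2] [q1 q2]; rewrite IHE /L_shape /=; subst.
  rewrite (@unit_step_cons a2 y); last by clear IHE IH; lia.
  rewrite !unit_stepxx [unit_step x _ _ _]unit_stepC.
  by do ?[case: eqP => //= _]; rewrite ?andbF ?andbT ?orbT ?orbF.
- exists b1, b2, a1, y; split; last by left; split=> //; clear IHE IH; lia.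
  have {n0} ex : e = x by apply: n0; clear IHE IH; lia.
  move=> [p1 p2] [q1 q2]; rewrite IHE /L_shape /=; subst.
  rewrite (@unit_step_cons a1 x); last by clear IHE IH; lia.
  rewrite !unit_stepxx [unit_step y _ _ _]unit_stepC.
  by do ?[case: eqP => //= _]; rewrite ?andbF ?andbT ?orbT ?orbF.
- exists x, y, e, a2; split; last by right; split=> //; clear IHE IH; lia.
  move=> [p1 p2] [q1 q2]; rewrite IHE /L_shape /=; subst.
  rewrite (@unit_step_cons a2 b2); last by clear IHE IH; lia.
  by do ?[case: eqP => //= _]; rewrite ?andbF ?andbT ?orbT ?orbF.
Qed.

Lemma one_bend_L_shape (p : seq grid_point) :
  is_path grid_adj p -> (bends p <= 1)%N ->
  exists x y a b, path_edge p =2 L_shape x y a b.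
Proof.
case: p => [|a [|b s]] // => [_ _|/andP[pth Us] le1].
  exists 0, 0, 0, 0 => x y.
  by rewrite path_edge1 /L_shape !unit_stepxx !andbF.
by have [x [y [e [f [H _]]]]] := L_path pth Us le1; exists x, y, e, f.
Qed.

(** Together with [L_shape_swap], this reduces every edge to a horizontal one traversed in the
    positive direction. *)
Lemma L_shape_opp x y a b px py qx qy :
  L_shape (- x) y (- a) b (- px, py) (- qx, qy) =
  L_shape x y a b (px, py) (qx, qy).
Proof.
have opp c d s t : unit_step (- c) (- d) (- s) (- t) = unit_step c d s t.
  by rewrite /unit_step; apply/idP/idP; lia.
by rewrite /L_shape /= opp !eqr_opp.
Qed.

Lemma L_shape_swap x y a b px py qx qy :
  L_shape y x b a (py, px) (qy, qx) = L_shape x y a b (px, py) (qx, qy).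
Proof. exact: orbC. Qed.

Section GridBridge.
Variables (G : sgraph) (V : finType) (E : G -> rel V).
Hypotheses (chordalG : chordal G) (E_sym : forall v, symmetric (E v)).
Hypothesis adjE : forall u v, u != v ->
  (adj u v <-> exists p q, E u p q /\ E v p q).

(** The coordinates are arbitrary functions, so that the lemma applies after reflecting or swapping
    the axes. The sides are the half-planes to the left and right of the middle of [p0q0]. *)
Lemma horizontal_bridge (hx hy : V -> int) (x y a b : G -> int) v p0 q0 :
  (forall p q, hx p = hx q -> hy p = hy q -> p = q) ->
  (forall w p q, E w p q =
     L_shape (x w) (y w) (a w) (b w) (hx p, hy p) (hx q, hy q)) ->
  E v p0 q0 -> hx q0 = hx p0 + 1 ->
  bridge (node_adj E) (node E (p0, q0)) (node E (q0, p0)).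
Proof.
move=> h_inj EL vpq step; have hy0 : hy q0 = hy p0.
  by move: vpq; rewrite EL /L_shape /unit_step /=; lia.
pose i := hx p0; pose j := hy p0.
have SE w : E w p0 q0 = (y w == j) && ((a w <= i < x w) || (x w <= i < a w)).
  rewrite EL /L_shape /unit_step /= step hy0 -/i -/j.
  by apply/idP/idP; lia.
have edge w p q : E w p q ->
    (hy p = y w /\ hy q = y w /\ (hx p = hx q + 1 \/ hx q = hx p + 1) /\
       ((a w <= hx p /\ a w <= hx q /\ hx p <= x w /\ hx q <= x w) \/
        (x w <= hx p /\ x w <= hx q /\ hx p <= a w /\ hx q <= a w))) \/
    (hx p = x w /\ hx q = x w /\ (hy p = hy q + 1 \/ hy q = hy p + 1)).
  by rewrite EL /L_shape /unit_step /=; lia.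
apply: (@node_bridge _ _ _ E_sym chordalG adjE _ _ (fun p => hx p <= i)).
- by rewrite /i.
- by rewrite step -/i; lia.
- move=> w p q; rewrite SE => wE /edge wpq sp sq.
  have [px qx] : hx p = hx p0 /\ hx q = hx q0 by rewrite step -/i; lia.
  by split; apply: h_inj => //; rewrite ?hy0 -/j; lia.
(* If [w] meets [s] on the left, then [x w <= i]: the shared edge is in the column of [w], or it is
   in row [j] and the whole horizontal arm of [w] lies on the left. Meeting [s'] on the right
   likewise gives [i < x w]. *)
- move=> s s' w; rewrite !SE => sE s'E wE /existsP[p /existsP[q]].
  case/and4P=> /edge spq /edge wpq /eqP pl /eqP ql.
  apply/existsP => -[p' /existsP[q' /and4P[/edge spq' /edge wpq' /eqP pr /eqP qr]]].
  move: sE s'E wE spq wpq pl ql spq' wpq' pr qr; clear.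
  move: (x s) (y s) (a s) (x s') (y s') (a s') (x w) (y w) (a w).
  move: (hx p) (hy p) (hx q) (hy q) (hx p') (hy p') (hx q') (hy q').
  move=> *; lia.
(* As above [x w <= i < x u], so [w] and [u] share no vertical edge. The column of [s] lies on one
   side only, so [w] or [u] meets [s] in row [j]. A shared horizontal edge would then put both arms
   in row [j], but on opposite sides. *)
- move=> s w u; rewrite !SE => sE wE uE /existsP[p /existsP[q]].
  case/and4P=> /edge spq /edge wpq /eqP pl /eqP ql.
  case/existsP=> p' /existsP[q' /and4P[/edge spq' /edge upq' /eqP pr /eqP qr]].
  apply/negP => wu; have /adjE : w != u.
    by apply: contraTneq wu => ->; rewrite adj_irr.
  case=> /(_ wu) [p'' [q'' [/edge wpq'' /edge upq'']]] _.
  move: sE wE uE spq wpq pl ql spq' upq' pr qr wpq'' upq''; clear.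
  move: (x s) (y s) (a s) (x u) (y u) (a u) (x w) (y w) (a w).
  move: (hx p) (hy p) (hx q) (hy q) (hx p') (hy p') (hx q') (hy q').
  move: (hx p'') (hy p'') (hx q'') (hy q'').
  move=> p1'' p2'' q1'' q2'' p1 p2 q1 q2 p1' p2' q1' q2' xs ys as_ xu yu au xw yw aw.
  move=> sE wE uE spq wpq pl ql spq' upq' pr qr wpq'' upq''.
  have {sE} ysj : ys = j by case/andP: sE => /eqP.
  have {}wE : yw <> j \/ (xw <= i /\ aw <= i) \/ (i < xw /\ i < aw).
    by clear -wE; lia.
  have {}uE : yu <> j \/ (xu <= i /\ au <= i) \/ (i < xu /\ i < au).
    by clear -uE; lia.
  have {wpq pl ql q1 q2 spq} Hw : (xw = xs /\ xw <= i) \/ (yw = j /\ xw <= i /\ aw <= i).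
    clear -ysj wE spq wpq pl ql.
    by case: spq wpq => [] h1 [] h2; case: wE => [wE|[] wE]; lia.
  have {upq' pr qr p1' p2' q1' q2' spq'} Hu :
      (xu = xs /\ i < xu) \/ (yu = j /\ i < xu /\ i < au).
    clear -ysj uE spq' upq' pr qr.
    by case: spq' upq' => [] h1 [] h2; case: uE => [uE|[] uE]; lia.
  clear -wpq'' upq'' Hw Hu wE uE.
  by case: wpq'' upq'' => [] h1 [] h2; case: Hw => Hw; case: Hu => Hu;
    try lia; case: wE => [wE|[] wE]; case: uE => [uE|[] uE]; lia.
Qed.

Lemma grid_bridge (pos : V -> grid_point) v p0 q0 :
  injective pos ->
  (forall w, exists x y a b, forall p q, E w p q = L_shape x y a b (pos p) (pos q)) ->
  E v p0 q0 ->
  bridge (node_adj E) (node E (p0, q0)) (node E (q0, p0)).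
Proof.
move=> pos_inj /fin_all_exists[x /fin_all_exists[y /fin_all_exists[a
  /fin_all_exists[b EL]]]] vpq.
pose X p := (pos p).1; pose Y p := (pos p).2.
have XY p : pos p = (X p, Y p) by apply: surjective_pairing.
have inj p q : X p = X q -> Y p = Y q -> p = q.
  by move=> Xpq Ypq; apply: pos_inj; rewrite !XY Xpq Ypq.
have {EL} EL w p q : E w p q = L_shape (x w) (y w) (a w) (b w) (X p, Y p) (X q, Y q).
  by rewrite EL !XY.
have : X q0 = X p0 + 1 \/ - X q0 = - X p0 + 1 \/ Y q0 = Y p0 + 1 \/ - Y q0 = - Y p0 + 1.
  by move: vpq; rewrite EL /L_shape /unit_step /=; clear; lia.
case=> [|[|[|]]] step.
- exact: horizontal_bridge inj EL vpq step.
- apply: (@horizontal_bridge (fun p => - X p) Y (fun w => - x w) y (fun w => - a w) b)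
    vpq step => [p q /oppr_inj|w p q]; first exact: inj.
  by rewrite L_shape_opp.
- apply: (@horizontal_bridge Y X y x b a) vpq step => [p q Ypq Xpq|w p q].
    exact: inj.
  by rewrite L_shape_swap.
- apply: (@horizontal_bridge (fun p => - Y p) X (fun w => - y w) x (fun w => - b w) a)
    vpq step => [p q /oppr_inj Ypq Xpq|w p q]; first exact: inj.
  by rewrite L_shape_opp L_shape_swap.
Qed.

End GridBridge.

End Grid.

Lemma chordal_B1_EPG_EPT (G : sgraph) : chordal G -> B_EPG 1 G -> EPT G.
Proof.
move=> chordalG [P [P_path P_rep]].
(* Darts need a finite type of points, so the grid is cut down to the points on the paths. *)
pose pts := flatten [seq P v | v <- enum G].
have mem_pts v p : p \in P v -> p \in pts.
  by move=> pv; apply/flatten_mapP; exists v; rewrite ?mem_enum.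
pose Q v : seq (seq_sub pts) := pmap insub (P v).
have valQ v : map val (Q v) = P v.
  rewrite /Q (pmap_filter (insubK _)); apply/all_filterP/allP => p pv.
  by case: insubP => //; rewrite (mem_pts _ _ pv).
have edgeQ v p q : path_edge (Q v) p q = path_edge (P v) (val p) (val q).
  by rewrite -valQ path_edge_map //; apply: val_inj.
have Q_uniq v : uniq (Q v).
  rewrite -(map_inj_uniq val_inj) valQ; have [+ _] := P_path v.
  by case: (P v) => //= p s /andP[].
have Q_rep : edge_intersection_rep Q.
  move=> u v uv; apply: iff_trans (P_rep u v uv) _; split=> -[p [q [up vp]]].
    have [pu qu] := path_edge_mem up.
    exists (SeqSub (mem_pts _ _ pu)), (SeqSub (mem_pts _ _ qu)).
    by rewrite !edgeQ.
  by exists (val p), (val q); rewrite -!edgeQ.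
apply: (EPT_of_bridges _ Q_uniq Q_rep) => [v|v p q].
  rewrite -size_eq0 -(size_map val) valQ size_eq0.
  by have [+ _] := P_path v; case: (P v).
apply: (grid_bridge chordalG _ Q_rep val_inj) => [u|w].
  exact: path_edge_sym.
have [w_path w_bends] := P_path w.
have [x [y [a [b H]]]] := one_bend_L_shape w_path w_bends.
by exists x, y, a, b => s t; rewrite edgeQ H.
Qed.

(** * The 4-cycle shows that the containment is proper *)

Definition C4_adj (x y : bool * bool) : bool := (x.1 == y.1) (+) (x.2 == y.2).

Lemma C4_sym : symmetric C4_adj.
Proof. by case=> [[] []] [[] []]. Qed.

Lemma C4_irr : irreflexive C4_adj.
Proof. by case=> [[] []]. Qed.

Definition C4 := SGraph C4_sym C4_irr.

Lemma C4_not_chordal : ~ chordal C4.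
Proof.
pose c : seq C4 := [:: (false, false); (false, true); (true, true); (true, false)].
move=> /(_ c) H; suff /H : induced_cycle c by [].
split=> //; case=> [[] []] [[] []] _ _ //= _; by [left | right].
Qed.

(* [C4] is the intersection graph of four two-leaf paths of a star, two of
   whose leaves stand for the first coordinate and two for the second. *)
Lemma C4_EPT : EPT C4.
Proof.
(* In the edgeless graph every vertex is its own root, so [rooted_tree] is the star with centre
   [None]. *)
pose e0 (x y : bool + bool) := false.
have e0_sym : symmetric e0 by [].
have e0_irr : irreflexive e0 by [].
have root0 x : fingraph.root e0 x = x.
  by have /connectP[[|y p]] := connect_root e0 x.
exists (rooted_tree e0_sym e0_irr); first exact: rooted_tree_is_tree.
exists (fun v => [:: Some (inl v.1); None; Some (inr v.2)]); split=> [v|u v uv].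
  by rewrite /= !root0 !eqxx.
split=> [|[a [b []]]].
  case: u v uv => [a b] [c d] uv /=; rewrite /C4_adj /=.
  have [->|ac] := eqVneq a c => [_|/eqP bd].
    exists (Some (inl c)), None.
    by rewrite !path_edge_cons !eqxx.
  exists None, (Some (inr d)).
  by rewrite !path_edge_cons bd !eqxx !orbT.
rewrite !path_edge_cons !path_edge1 !orbF.
case: u v uv => [x y] [z t] uv /=; rewrite /C4_adj /=.
by case: a b => [[[]|[]]|] [[[]|[]]|] //=; move: x y z t uv => [] [] [] [].
Qed.

Theorem theorem4 :
  (forall G : sgraph, chordal G /\ B_EPG 1 G -> EPT G) /\
  (exists G : sgraph, EPT G /\ ~ (chordal G /\ B_EPG 1 G)).
Proof.
split=> [G []|]; first exact: chordal_B1_EPG_EPT.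
by exists C4; split; [apply: C4_EPT | case=> /C4_not_chordal].
Qed.
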